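(* Let $P$ be a nonempty set of propositional letters and $R$ a nonempty set of reason symbols containing the symbol $\sigma$. For every formula $\varphi\in F$: $\mathsf{RBB}_\sigma\vdash\varphi$ iff $\varphi$ is true at every world of every model satisfying (ma), (mb), (mr); and $\mathsf{RBB}_\sigma^+\vdash\varphi$ iff $\varphi$ is true at every world of every model satisfying (ma), (mb), (mr), (mt).
   Context: Language: $F$ is given by $\varphi ::= p \mid \neg\varphi \mid (\varphi\lor\varphi) \mid (r:\varphi) \mid r \mid B\varphi$ with $p\in P$, $r\in R$ ($P,R$ nonempty, not necessarily disjoint); other connectives are abbreviations. $\mathsf{RBB}$ has axiom schemes (CL) classical propositional tautologies; (RK) $r:(\varphi\to\psi)\to(r:\varphi\to r:\psi)$; (A) $r:\varphi\to(r\to\varphi)$; (RB) $r:\varphi\to(Br\to B\varphi)$; (D) $B\varphi\to\neg B\neg\varphi$; rules (MP) modus ponens; (RN) from $\varphi$ infer $r:\varphi$; (E) from $\varphi\leftrightarrow\psi$ infer $B\varphi\leftrightarrow B\psi$. $\mathsf{RBB}_\sigma$ is $\mathsf{RBB}$ plus the schemes (MA) $\sigma\to(Br\to r)$, (MB) $B\sigma$, (MR) $r:\varphi\to(Br\to\sigma:\varphi)$ (for all $r\in R$, $\varphi\in F$). $\mathsf{RBB}_\sigma^+$ is $\mathsf{RBB}_\sigma$ plus (MT) $B\varphi\to\sigma:\varphi$. Models: $M=(W,[\cdot],N,V)$, $W\neq\emptyset$, $[r]\subseteq W\times W$ for $r\in R$, $N:W\to\wp(\wp(W))$, $V:W\to\wp(P)$;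 $r(w)=\{v:(w,v)\in[r]\}$, $r^\circ=\{v:(v,v)\in[r]\}$; required: (pr) for $x\in P\cap R$, $x\in V(w)$ iff $w\in x(w)$; (d) $X\in N(w)\Rightarrow W-X\notin N(w)$; (rb) $r(w)\subseteq X$ and $r^\circ\in N(w)$ imply $X\in N(w)$. Extra conditions: (ma) $w\in\sigma(w)$ and $r^\circ\in N(w)$ imply $w\in r(w)$; (mb) $\sigma^\circ\in N(w)$; (mr) $r(w)\subseteq X$ and $r^\circ\in N(w)$ imply $\sigma(w)\subseteq X$; (mt) $X\in N(w)$ implies $\sigma(w)\subseteq X$ (all for every $w\in W$, $r\in R$, $X\subseteq W$). Satisfaction: $M,w\models p$ iff $p\in V(w)$; Boolean clauses standard; $M,w\models r:\varphi$ iff $r(w)\subseteq[\![\varphi]\!]_M$; $M,w\models r$ iff $w\in r(w)$; $M,w\models B\varphi$ iff $[\![\varphi]\!]_M\in N(w)$, where $[\![\varphi]\!]_M$ is the set of worlds satisfying $\varphi$. *)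

(* Defs.v *)
From mathcomp Require Import all_boot.
From mathcomp Require Import boolp classical_sets.

Set Implicit Arguments.
Unset Strict Implicit.
Unset Printing Implicit Defensive.

Local Open Scope classical_set_scope.

Section Syntax.
Variables (U : Type) (P R : set U).

(* P and R are arbitrary sets of symbols of a common type U, so that they may
   overlap. A symbol x in both P and R yields a single atomic formula,
   [Sym x], whether it is read as a letter or as a reason: membership proofs
   in [set_type] are boolean equalities, hence irrelevant. *)
Inductive form : Type :=
| Sym of P `|` R
| Neg of form
| Or of form & form
| Rsn of R & form
| Bel of form.

Lemma letter_subproof (p : P) : sval p \in P `|` R.
Proof. by rewrite in_setU (svalP p). Qed.

Lemma reason_subproof (r : R) : sval r \in P `|` R.
Proof. by rewrite in_setU (svalP r) orbT. Qed.

Definition FLetter (p : P) : form := Sym (exist _ (sval p) (letter_subproof p)).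
Definition FReason (r : R) : form := Sym (exist _ (sval r) (reason_subproof r)).

Lemma FLetter_FReason (p : P) (r : R) :
  sval p = sval r -> FLetter p = FReason r.
Proof. by move=> e; congr Sym; apply: val_inj. Qed.

Definition And (a b : form) : form := Neg (Or (Neg a) (Neg b)).
Definition Imp (a b : form) : form := Or (Neg a) b.
Definition Iff (a b : form) : form := And (Imp a b) (Imp b a).

(* Every formula that is not a negation or a disjunction is treated as a
   propositional variable. *)
Fixpoint peval (v : form -> bool) (a : form) : bool :=
  match a with
  | Neg b => ~~ peval v b
  | Or b c => peval v b || peval v c
  | _ => v a
  end.

Definition tautology (a : form) : Prop := forall v, peval v a.

(* Theorems of RBB extended with the axioms Ax. *)
Inductive RBB_with (Ax : set form) : form -> Prop :=
| RBB_Ax a : Ax a -> RBB_with Ax a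
| RBB_CL a : tautology a -> RBB_with Ax a
| RBB_RK r a b : RBB_with Ax (Imp (Rsn r (Imp a b)) (Imp (Rsn r a) (Rsn r b)))
| RBB_A r a : RBB_with Ax (Imp (Rsn r a) (Imp (FReason r) a))
| RBB_RB r a : RBB_with Ax (Imp (Rsn r a) (Imp (Bel (FReason r)) (Bel a)))
| RBB_D a : RBB_with Ax (Imp (Bel a) (Neg (Bel (Neg a))))
| RBB_MP a b : RBB_with Ax (Imp a b) -> RBB_with Ax a -> RBB_with Ax b
| RBB_RN r a : RBB_with Ax a -> RBB_with Ax (Rsn r a)
| RBB_E a b : RBB_with Ax (Iff a b) -> RBB_with Ax (Iff (Bel a) (Bel b)).

Variable sigma : R.

Inductive sigma_axiom : form -> Prop :=
| sigma_MA r :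
    sigma_axiom (Imp (FReason sigma) (Imp (Bel (FReason r)) (FReason r)))
| sigma_MB : sigma_axiom (Bel (FReason sigma))
| sigma_MR r a :
    sigma_axiom (Imp (Rsn r a) (Imp (Bel (FReason r)) (Rsn sigma a))).

Inductive sigma_plus_axiom : form -> Prop :=
| sigma_plus_base a : sigma_axiom a -> sigma_plus_axiom a
| sigma_plus_MT a : sigma_plus_axiom (Imp (Bel a) (Rsn sigma a)).

Definition RBB_sigma : form -> Prop := RBB_with sigma_axiom.
Definition RBB_sigma_plus : form -> Prop := RBB_with sigma_plus_axiom.

End Syntax.

Definition succ (W : Type) (e : set (W * W)) (w : W) : set W :=
  [set v | e (w, v)].

Definition loops (W : Type) (e : set (W * W)) : set W := [set v | e (v, v)].

Section Semantics.
Variables (U : Type) (P R : set U).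

Record model : Type := Model {
  world : Type;
  rel : R -> set (world * world);
  nbh : world -> set (set world);
  valuation : world -> set P;
  world_inhabited : inhabited world;
  model_pr : forall (p : P) (r : R) (w : world),
    sval p = sval r -> (valuation w p <-> succ (rel r) w w);
  model_d : forall (w : world) (X : set world), nbh w X -> ~ nbh w (~` X);
  model_rb : forall (w : world) (r : R) (X : set world),
    succ (rel r) w `<=` X -> nbh w (loops (rel r)) -> nbh w X
}.

(* The two disjuncts of the atomic case are the clauses for letters and for
   reasons; by [model_pr] they agree on symbols in both P and R, see
   [sat_letter] and [sat_reason]. *)
Fixpoint sat (M : model) (w : world M) (a : form P R) : Prop :=
  match a with
  | Sym x => (exists2 p : P, sval p = sval x & valuation w p)
             \/ (exists2 r : R, sval r = sval x & succ (rel r) w w)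
  | Neg b => ~ sat w b
  | Or b c => sat w b \/ sat w c
  | Rsn r b => succ (rel r) w `<=` [set v | sat v b]
  | Bel b => nbh w [set v | sat v b]
  end.

Lemma sat_letter (M : model) (w : world M) (p : P) :
  sat w (FLetter R p) <-> valuation w p.
Proof.
split=> [[[q /= e vq]|[r /= e wr]]|vp]; last by left; exists p.
- by have <- : q = p by apply: val_inj.
- by apply/(model_pr (r := r)).
Qed.

Lemma sat_reason (M : model) (w : world M) (r : R) :
  sat w (FReason P r) <-> succ (rel r) w w.
Proof.
split=> [[[p /= e vp]|[s /= e ws]]|wr]; last by right; exists r.
- by apply/(model_pr (p := p)).
- by have <- : s = r by apply: val_inj.
Qed.

Definition cond_ma (sigma : R) (M : model) : Prop :=
  forall (w : world M) (r : R),
    succ (rel sigma) w w -> nbh w (loops (rel r)) -> succ (rel r) w w.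

Definition cond_mb (sigma : R) (M : model) : Prop :=
  forall w : world M, nbh w (loops (rel sigma)).

Definition cond_mr (sigma : R) (M : model) : Prop :=
  forall (w : world M) (r : R) (X : set (world M)),
    succ (rel r) w `<=` X -> nbh w (loops (rel r)) -> succ (rel sigma) w `<=` X.

Definition cond_mt (sigma : R) (M : model) : Prop :=
  forall (w : world M) (X : set (world M)), nbh w X -> succ (rel sigma) w `<=` X.

End Semantics.

(* Main.v *)
Require Import Defs.
From mathcomp Require Import all_boot.
From mathcomp Require Import boolp classical_sets.

Set Implicit Arguments.
Unset Strict Implicit.
Unset Printing Implicit Defensive.

Local Open Scope classical_set_scope.

(** Soundness is an induction on derivations. Completeness uses a canonical
    model with two adjustments. Since [r] is true at [w] exactly when [w] is an
    [r]-successor of itself, a maximal theory [T] may have to be accessible from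
    itself (if [r : a] in [T] always implies [a] in [T]) without being a loop
    (if [r] is not in [T]); so every maximal theory is taken twice, and a loop
    is removed when [r] is not in the theory, the other copy remaining as a
    successor. The neighbourhoods of [w] are the truth sets of the formulas
    believed at [w], together with all supersets of [sigma(w)]: by (MA) and (MR)
    these include all supersets of [r(w)] whenever [B r] holds at [w], which
    gives (rb), and (d) holds because [sigma(w)] is nonempty. *)

(** * Soundness for an arbitrary set of extra axioms *)

Section Soundness.
Variables (U : Type) (P R : set U).
Implicit Types (M : model P R) (a b : form P R) (r : R).

Definition valid M a := forall w : world M, sat w a.

Lemma sat_Imp M (w : world M) a b : sat w (Imp a b) <-> (sat w a -> sat w b).
Proof.
split=> [[na /na//|//]|ab] /=.
by case: (pselect (sat w a)) => [/ab|]; [right|left].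
Qed.

Lemma sat_Iff M (w : world M) a b : sat w (Iff a b) <-> (sat w a <-> sat w b).
Proof.
have -> : sat w (Iff a b) <-> (sat w (Imp a b) /\ sat w (Imp b a)).
  by rewrite /= not_orE !not_notE.
by rewrite !sat_Imp.
Qed.

(** Truth at [w] is itself a Boolean valuation, which [peval] extends over negation and disjunction
    just as [sat] does. *)
Lemma tautology_valid M a : tautology a -> valid M a.
Proof.
move=> ta w; apply/asboolP; have := ta (fun b => `[< sat w b >]).
suff -> : peval (fun b => `[< sat w b >]) a = `[< sat w a >] by [].
elim: a {ta} => //= [a ->|a -> b ->]; first by rewrite asbool_neg.
by rewrite asbool_or.
Qed.

Lemma Bel_FReason M (w : world M) r :
  sat w (Bel (FReason P r)) <-> nbh w (loops (Defs.rel (m:=M) r)).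
Proof.
rewrite /sat -/(sat (M:=M)).
suff -> : [set v | sat v (FReason P r)] = loops (Defs.rel (m:=M) r) by [].
by apply/seteqP; split=> v /sat_reason.
Qed.

Lemma RBB_with_sound (Ax : set (form P R)) M a :
  (forall b, Ax b -> valid M b) -> RBB_with Ax a -> valid M a.
Proof.
move=> sAx; elim=> {a} [a /sAx//|a /tautology_valid//|r a b|r a|r a|a|a b _ ab _ sa
  |r a _ sa|a b _ ab] w.
- apply/sat_Imp=> rab; apply/sat_Imp=> ra v wv.
  by move/sat_Imp: (rab v wv); apply; exact: ra.
- by apply/sat_Imp=> ra; apply/sat_Imp=> /sat_reason/ra.
- apply/sat_Imp=> ra; apply/sat_Imp=> /Bel_FReason; exact: model_rb.
- by apply/sat_Imp=> Ba; exact: (model_d Ba).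
- by move/sat_Imp: (ab w); apply.
- by move=> v _; exact: sa.
- apply/sat_Iff => /=.
  suff -> : [set v : world M | sat v a] = [set v | sat v b] by [].
  by apply/seteqP; split=> v /=; have /sat_Iff[] := ab v.
Qed.

Variable sigma : R.

Lemma sigma_axiom_valid M :
  cond_ma sigma M -> cond_mb sigma M -> cond_mr sigma M ->
  forall a, sigma_axiom sigma a -> valid M a.
Proof.
move=> ma mb mr _ [r||r a] w.
- apply/sat_Imp=> /sat_reason ws; apply/sat_Imp=> /Bel_FReason Br.
  exact/sat_reason/ma.
- exact/Bel_FReason.
- by apply/sat_Imp=> ra; apply/sat_Imp=> /Bel_FReason; exact: mr.
Qed.

End Soundness.

(** * Theories and Lindenbaum's lemma *)

Section Theories.
Variables (U : Type) (P R : set U) (Ax : set (form P R)).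
Implicit Types (a b c : form P R) (T : set (form P R)).

(** Closure is under (MP) only: (RN) and (E) preserve theoremhood, not membership in a theory. *)
Definition theory T :=
  RBB_with Ax `<=` T /\ forall a b, T (Imp a b) -> T a -> T b.

Definition maximal_theory T := theory T /\ forall a, T (Neg a) <-> ~ T a.

Lemma theory_RBB : theory (RBB_with Ax).
Proof. by split=> // a b; exact: RBB_MP. Qed.

Lemma theory_taut {T a} : theory T -> tautology a -> T a.
Proof. by move=> [TAx _] ta; exact/TAx/RBB_CL. Qed.

(** This is the theory generated by [T] and [a]; it takes the place of a deduction theorem. *)
Lemma theory_adjoin {T} a : theory T -> theory [set b | T (Imp a b)].
Proof.
move=> tT; split=> [b pb|b c /= abc ab].
  apply: (tT.2 b); last exact: tT.1.
  by apply: theory_taut => // v /=; do 2!case: (peval v _).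
apply: tT.2 ab; apply: tT.2 abc.
by apply: theory_taut => // v /=; do 3!case: (peval v _).
Qed.

Lemma theory_Rsn {T} (r : R) : theory T -> theory [set a | T (Rsn r a)].
Proof.
move=> tT; split=> [a pa|a b /= rab]; first exact/tT.1/RBB_RN.
exact/tT.2/(tT.2 _ _ _ rab)/tT.1/RBB_RK.
Qed.

Lemma lindenbaum {T a} : theory T -> ~ T a ->
  exists S, [/\ maximal_theory S, T `<=` S & ~ S a].
Proof.
move=> tT Ta.
(* Joining [T] lets the empty chain satisfy the hypothesis of Zorn's lemma. *)
pose good := [set A : set (form P R) | theory (A `|` T) /\ ~ (A `|` T) a].
have [F Fgood totF|A [[tA Aa] Amax]] := @Zorn_bigcup _ good.
  split; last by move=> [[A FA Aa]|//]; case: (Fgood A FA) => _; apply; left.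
  split=> [b /tT.1|b c]; first by right.
  have mp A : F A -> (A `|` T) (Imp b c) -> (A `|` T) b ->
      (\bigcup_(X in F) X `|` T) c.
    move=> FA Abc Ab; have [[_ tA] _] := Fgood A FA.
    by case: (tA _ _ Abc Ab) => [Ac|]; [left; exists A|right].
  move=> [[A FA Abc]|Tbc] [[B FB Bb]|Tb].
  - case: (totF A B FA FB) => [AB|BA].
    + by apply: (mp B) => //; left=> //; exact: AB.
    + by apply: (mp A) => //; left=> //; exact: BA.
  - by apply: (mp A) => //; [left|right].
  - by apply: (mp B) => //; [right|left].
  - by right; exact: tT.2 Tbc Tb.
exists (A `|` T); split=> //.
set S := A `|` T in tA Aa *.
(* Otherwise [S] with [b] adjoined is a strictly larger theory that still omits [a], against
   maximality. *)
have step b : ~ S b -> S (Imp b a).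
  move=> Sb; apply: contrapT => Sba.
  pose B := [set c | S (Imp b c)].
  have SB : S `<=` B.
    move=> c Sc; apply: tA.2 Sc; apply: theory_taut => // v /=.
    by do 2!case: (peval v _).
  have BT : B `|` T = B.
    by apply/setUidPl => c Tc; apply: SB; right.
  apply: (Amax B); last by rewrite /good /= BT; split; [exact: theory_adjoin|case].
  split=> [c Ac|BA]; first by apply: SB; left.
  apply: Sb; left; apply: BA; apply: (theory_taut tA) => v /=.
  by case: (peval v b).
split=> // b; split=> [Snb Sb|/step Sba].
  apply: Aa; apply: tA.2 Sb; apply: tA.2 Snb; apply: theory_taut => // v /=.
  by do 2!case: (peval v _).
(* If [S] omitted both [b] and its negation, each would imply [a] in [S], and so [S] would contain
   [a]. *)
apply: contrapT => /step Snba; apply: Aa.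
apply: tA.2 Snba; apply: tA.2 Sba; apply: theory_taut => // v /=.
by do 2!case: (peval v _).
Qed.

Lemma maximal_Or {T a b} : maximal_theory T -> T (Or a b) <-> T a \/ T b.
Proof.
move=> [tT nT]; split=> [Tab|[Ta|Tb]].
- case: (pselect (T a)) => [|/nT Tna]; [by left|right].
  apply: tT.2 Tna; apply: tT.2 Tab; apply: theory_taut => // v /=.
  by do 2!case: (peval v _).
- apply: tT.2 Ta; apply: theory_taut => // v /=.
  by do 2!case: (peval v _).
- apply: tT.2 Tb; apply: theory_taut => // v /=.
  by do 2!case: (peval v _).
Qed.

End Theories.

(** * The canonical model and completeness *)

Section CanonicalModel.
Variables (U : Type) (P R : set U) (sigma : R) (Ax : set (form P R)).
Hypothesis sigmaAx : sigma_axiom sigma `<=` Ax.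
Implicit Types (a b : form P R) (r : R).

Definition cworld : Type := {T : set (form P R) | maximal_theory Ax T} * bool.

Definition holds (w : cworld) : set (form P R) := sval w.1.
Definition extent a : set cworld := [set w | holds w a].

Definition crel r : set (cworld * cworld) :=
  [set e | (forall a, holds e.1 (Rsn r a) -> holds e.2 a) /\
           (e.1 = e.2 -> holds e.1 (FReason P r))].

Definition cnbh (w : cworld) : set (set cworld) :=
  [set X | (exists2 a, X = extent a & holds w (Bel a))
           \/ succ (crel sigma) w `<=` X].

Definition cvaluation (w : cworld) : set P := [set p | holds w (FLetter R p)].

Lemma holds_theory w : theory Ax (holds w).
Proof. by case: (svalP w.1). Qed.

Lemma holds_MP {w a b} : holds w (Imp a b) -> holds w a -> holds w b.
Proof. by case: (holds_theory w) => _; apply. Qed.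

Lemma holds_RBB w {a} : RBB_with Ax a -> holds w a.
Proof. by case: (holds_theory w) => + _; apply. Qed.

Lemma holds_sigma w {a} : sigma_axiom sigma a -> holds w a.
Proof. by move=> /sigmaAx ax; exact/holds_RBB/RBB_Ax. Qed.

Lemma holds_Neg w a : holds w (Neg a) <-> ~ holds w a.
Proof. by case: (svalP w.1) => _; apply. Qed.

Lemma holds_Or w a b : holds w (Or a b) <-> holds w a \/ holds w b.
Proof. exact: maximal_Or (svalP w.1). Qed.

Lemma extent_Neg a : ~` extent a = extent (Neg a).
Proof. by apply/seteqP; split=> w /= /holds_Neg. Qed.

Lemma world_avoiding {T a} (i : bool) : theory Ax T -> ~ T a ->
  exists w : cworld, [/\ w.2 = i, T `<=` holds w & ~ holds w a].
Proof.
by move=> tT /(lindenbaum tT)[S [mS TS Sa]]; exists (exist _ S mS, i).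
Qed.

(** An unprovable implication fails at some world. With (E), this makes belief depend only on the
    extent of a formula. *)
Lemma extent_sub a b : extent a `<=` extent b -> RBB_with Ax (Imp a b).
Proof.
move=> ab; apply: contrapT => /(world_avoiding true (theory_RBB Ax))[w [_ _]].
by case/holds_Or; case: (pselect (holds w a)) => [/ab|/holds_Neg]; [right|left].
Qed.

Lemma RBB_Iff a b :
  RBB_with Ax (Imp a b) -> RBB_with Ax (Imp b a) -> RBB_with Ax (Iff a b).
Proof.
move=> ab ba; apply: RBB_MP ba; apply: RBB_MP ab; apply: RBB_CL => v /=.
by do 2!case: (peval v _).
Qed.

Lemma extent_inj_Bel w a b : extent a = extent b ->
  holds w (Bel a) -> holds w (Bel b).
Proof.
move=> ab; apply: holds_MP; apply: holds_RBB.
have: RBB_with Ax (Iff (Bel a) (Bel b)).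
  by apply: RBB_E; apply: RBB_Iff; apply: extent_sub; rewrite ab.
apply: RBB_MP; apply: RBB_CL => v /=.
by case: (v (Bel a)); case: (v (Bel b)).
Qed.

Lemma crel_Rsn w r a : succ (crel r) w `<=` extent a <-> holds w (Rsn r a).
Proof.
split=> [ra|wra v [wv _]]; last exact: wv.
apply: contrapT => nra.
(* Taking [v] in the copy opposite to [w] makes the loop clause of [crel] vacuous. *)
have [v [vi rv]] := world_avoiding (~~ w.2) (theory_Rsn r (holds_theory w)) nra.
apply; apply: ra; split=> //= wv.
by move: vi; rewrite -wv; case: (w.2).
Qed.

(** The loop clause of [crel] gives one inclusion, axiom (A) the other. *)
Lemma loops_crel r : loops (crel r) = extent (FReason P r).
Proof.
apply/seteqP; split=> [w [_]|w wr]; first exact.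
split=> //= a wra; apply: holds_MP wr; apply: holds_MP wra.
exact/holds_RBB/RBB_A.
Qed.

Lemma holds_RB w r a :
  holds w (Rsn r a) -> holds w (Bel (FReason P r)) -> holds w (Bel a).
Proof. by move=> /(holds_MP (holds_RBB w (RBB_RB _ r a)))/holds_MP; exact. Qed.

(** The added supersets of sigma(w) create no new beliefs: if one is the extent of [a], then
    [Rsn sigma a] holds at [w], and (MB) with (RB) yields [Bel a]. *)
Lemma cnbh_extent w a : cnbh w (extent a) <-> holds w (Bel a).
Proof.
split=> [[[b ab]|/crel_Rsn /holds_RB]|Ba]; last by left; exists a.
  exact/extent_inj_Bel.
by apply; apply: holds_sigma; exact: sigma_MB.
Qed.

(** (MR) takes care of the first clause of [crel], (MA) of the loop clause. *)
Lemma succ_sigma w r : holds w (Bel (FReason P r)) ->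
  succ (crel sigma) w `<=` succ (crel r) w.
Proof.
move=> Br v [/= sv ws]; split=> /= [a ra|/ws{}ws].
  apply: sv; apply: holds_MP Br; apply: holds_MP ra.
  exact/holds_sigma/sigma_MR.
apply: holds_MP Br; apply: holds_MP ws; exact/holds_sigma/sigma_MA.
Qed.

Lemma holds_D w a : holds w (Bel a) -> ~ holds w (Bel (Neg a)).
Proof. by move=> /(holds_MP (holds_RBB w (RBB_D _ a)))/holds_Neg. Qed.

(** If sigma(w) were empty, every set would be a neighbourhood of [w], so a formula and its negation
    would both be believed, against (D). *)
Lemma succ_sigma_neq0 w : succ (crel sigma) w !=set0.
Proof.
apply/set0P/eqP => s0; pose a := FReason P sigma.
by apply: (@holds_D w a); apply/cnbh_extent; right; rewrite s0; exact: sub0set.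
Qed.

Lemma cmodel_pr (p : P) r w :
  sval p = sval r -> (cvaluation w p <-> succ (crel r) w w).
Proof.
move=> pr; have -> : succ (crel r) w w = loops (crel r) w by [].
by rewrite loops_crel /extent /= -(FLetter_FReason pr).
Qed.

Lemma cmodel_d w X : cnbh w X -> ~ cnbh w (~` X).
Proof.
move=> [[a -> Ba]|sX].
  by rewrite extent_Neg => /cnbh_extent; exact: holds_D.
(* When the complement of [X] is the extent of [a], [X] is the extent of [Neg a], which is then
   believed too. *)
move=> [[a aX Ba]|snX].
  apply: (holds_D Ba); apply/cnbh_extent; right.
  by rewrite -extent_Neg -aX setCK.
by have [v sv] := succ_sigma_neq0 w; exact: snX (sX v sv).
Qed.

Lemma cmodel_mr w r X : succ (crel r) w `<=` X ->
  cnbh w (loops (crel r)) -> succ (crel sigma) w `<=` X.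
Proof.
rewrite loops_crel => rX /cnbh_extent/succ_sigma sr.
exact: subset_trans rX.
Qed.

Lemma cmodel_rb w r X : succ (crel r) w `<=` X ->
  cnbh w (loops (crel r)) -> cnbh w X.
Proof. by move=> rX /(cmodel_mr rX); right. Qed.

(** The world [w0] only witnesses inhabitedness; [completeness] takes for it the world refuting the
    formula. *)
Definition cmodel (w0 : cworld) : model P R :=
  Model (inhabits w0) cmodel_pr cmodel_d cmodel_rb.

Lemma truth w0 (w : world (cmodel w0)) a : sat w a <-> holds w a.
Proof.
elim: a w => [x|a IH|a IHa b IHb|r a IH|a IH] w.
(* Read as a letter or as a reason, the symbol [x] gives the same formula [Sym x], as membership
   proofs are irrelevant. *)
- split=> [[[p px]|[r rx]]|wx] /=.
  + by rewrite /cvaluation /= (_ : FLetter R p = Sym x) //; congr Sym; exact: val_inj.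
  + rewrite -[succ _ _ _]/(loops (crel r) w) loops_crel /extent /=.
    by rewrite (_ : FReason P r = Sym x) //; congr Sym; exact: val_inj.
  + have := svalP x; rewrite in_setU => /orP[xP|xR]; [left|right].
      exists (exist _ (sval x) xP) => //; rewrite /cvaluation /=.
      by rewrite (_ : FLetter R _ = Sym x) //; congr Sym; exact: val_inj.
    exists (exist _ (sval x) xR) => //.
    rewrite -[succ _ _ _]/(loops (crel (exist _ (sval x) xR)) w) loops_crel.
    rewrite /extent /=.
    by rewrite (_ : FReason P _ = Sym x) //; congr Sym; exact: val_inj.
- by rewrite holds_Neg /= IH.
- by rewrite holds_Or /= IHa IHb.
- have <- := crel_Rsn w r a; rewrite /=.
  suff -> : [set v : world (cmodel w0) | sat v a] = extent a by [].
  by apply/seteqP; split=> v /IH.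
- have <- := cnbh_extent w a; rewrite /=.
  suff -> : [set v : world (cmodel w0) | sat v a] = extent a by [].
  by apply/seteqP; split=> v /IH.
Qed.

Lemma cmodel_cond_ma w0 : cond_ma sigma (cmodel w0).
Proof.
move=> w r [_ ws]; rewrite /= loops_crel => /cnbh_extent Br.
suff : loops (crel r) w by [].
rewrite loops_crel; apply: holds_MP Br; apply: holds_MP (ws _) => //.
exact/holds_sigma/sigma_MA.
Qed.

Lemma cmodel_cond_mb w0 : cond_mb sigma (cmodel w0).
Proof.
move=> w; rewrite /= loops_crel; apply/cnbh_extent.
exact/holds_sigma/sigma_MB.
Qed.

Lemma cmodel_cond_mr w0 : cond_mr sigma (cmodel w0).
Proof. exact: cmodel_mr. Qed.

Lemma cmodel_cond_mt w0 :
  (forall a, Ax (Imp (Bel a) (Rsn sigma a))) -> cond_mt sigma (cmodel w0).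
Proof.
move=> MT w X [[a -> Ba]|//]; apply/crel_Rsn; apply: holds_MP Ba.
exact/holds_RBB/RBB_Ax.
Qed.

Lemma completeness a :
  (forall w0 : cworld, valid (cmodel w0) a) -> RBB_with Ax a.
Proof.
move=> va; apply: contrapT => /(world_avoiding true (theory_RBB Ax))[w [_ _]].
by apply; apply/truth/(va w).
Qed.

End CanonicalModel.

Theorem mainTheorem2 (U : Type) (P R : set U)
    (P_neq0 : P !=set0) (R_neq0 : R !=set0) (sigma : R) (phi : form P R) :
  (RBB_sigma sigma phi <->
     forall M : model P R,
       cond_ma sigma M -> cond_mb sigma M -> cond_mr sigma M ->
       forall w : world M, sat w phi)
  /\
  (RBB_sigma_plus sigma phi <->
     forall M : model P R,
       cond_ma sigma M -> cond_mb sigma M -> cond_mr sigma M ->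
       cond_mt sigma M ->
       forall w : world M, sat w phi).
Proof.
split; split.
- move=> pphi M ma mb mr; apply: RBB_with_sound pphi.
  exact: sigma_axiom_valid.
- move=> vphi; apply: (@completeness _ _ _ sigma _ (@subset_refl _ _)) => w0.
  apply: vphi; [exact: cmodel_cond_ma|exact: cmodel_cond_mb|].
  exact: cmodel_cond_mr.
- move=> pphi M ma mb mr mt; apply: RBB_with_sound pphi => _ [a|a].
    exact: sigma_axiom_valid.
  by move=> w; apply/sat_Imp; exact: mt.
- move=> vphi.
  apply: (@completeness _ _ _ sigma _ (@sigma_plus_base _ _ _ sigma)) => w0.
  apply: vphi; [exact: cmodel_cond_ma|exact: cmodel_cond_mb| |].
    exact: cmodel_cond_mr.
  exact/cmodel_cond_mt/sigma_plus_MT.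
Qed.
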